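(* There is an infinite family of connected graphs such that for every graph $G=(V,E)$ in the family and $p=|V|$ robots, every set $F$ of new edges (between vertices of $V$, not already in $E$) for which $G+F$ is universally solvable for $p$ robots satisfies $|F|\ge \frac{|V|-1}{2}=\frac{p-1}{2}$.
   Context: Robots are $R=[p]$; a configuration on a graph $H=(V,E')$ is an injective map $S:R\to V$. A pair $(S,S')$ of configurations is a valid move if it is one of: (i) a simple path move: there is a simple path $(u_0,\dots,u_k)$ in $H$ with $u_k\notin S(R)$, $u_0\notin S'(R)$, $S'(i)=S(i)$ for robots not on the path, and $S'(i)=u_{j+1}$ whenever $S(i)=u_j$, $0\le j\le k-1$; (ii) a simple rotation move: there is a simple cycle $(u_0,\dots,u_{k-1},u_k=u_0)$ in $H$ all of whose vertices are occupied in $S$ and in $S'$, robots off the cycle stay fixed, and $S'(i)=u_{j+1}$ whenever $S(i)=u_j$; (iii) a dummy move $(S,S)$. $T$ is reachable from $S$ if there is a finite sequence $S=S_0,\dots,S_t=T$ with each $(S_{k-1},S_k)$ a valid move. $H$ is universally solvable for $p$ robots if every configuration is reachable from every other. *)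

(* Defs.v *)
From HB Require Import structures.
From mathcomp Require Import all_boot all_order all_algebra.
Set Implicit Arguments.
Unset Strict Implicit.
Unset Printing Implicit Defensive.

Record graph := Graph {
  vertex :> finType;
  edges : {set {set vertex}};
  edges_card2 : forall e, e \in edges -> #|e| = 2
}.

(* Irreflexive: [set x; x] is a singleton, hence not an edge. *)
Definition adj (G : graph) : rel G := fun x y => [set x; y] \in edges G.

Definition connected (G : graph) : Prop :=
  0 < #|G| /\ forall x y : G, connect (@adj G) x y.

Definition isomorphic (G H : graph) : Prop :=
  exists f : G -> H, bijective f /\ forall x y, adj (f x) (f y) = adj x y.

Definition non_edges (G : graph) : {set {set G}} :=
  [set e : {set G} | (#|e| == 2) && (e \notin edges G)].

Lemma add_edges_card2 (G : graph) (F : {set {set G}}) :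
  F \subset non_edges G -> forall e, e \in edges G :|: F -> #|e| = 2.
Proof.
move=> sF e; rewrite inE => /orP[/edges_card2//|/(subsetP sF)].
by rewrite inE => /andP[/eqP].
Qed.

Definition add_edges (G : graph) (F : {set {set G}})
    (newF : F \subset non_edges G) : graph :=
  Graph (add_edges_card2 newF).

Section Robots.
Variables (H : graph) (p : nat).

(* Injectivity is boolean, so configurations with the same map are equal. *)
Record config := Config {
  pos :> {ffun 'I_p -> H};
  pos_inj : injectiveb pos
}.

(* The path (u_0, ..., u_k) is u0 :: us, so k = size us. *)
Definition path_move (S S' : config) : Prop :=
  exists (u0 : H) (us : seq H), let u := u0 :: us in
    [/\ path (@adj H) u0 us && uniq u,
        last u0 us \notin codom S,
        u0 \notin codom S',
        forall i, S i \notin u -> S' i = S i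
      & forall i j, j < size us -> S i = nth u0 u j -> S' i = nth u0 u j.+1].

(* The cycle (u_0, ..., u_(k-1), u_0) is u = [:: u_0; ...; u_(k-1)]. A simple
   cycle has at least three vertices: traversing an edge back and forth does
   not count, so two robots cannot swap along an edge. *)
Definition rotation_move (S S' : config) : Prop :=
  exists u : seq H,
    [/\ 2 < size u /\ ucycle (@adj H) u,
        forall v, v \in u -> (v \in codom S) && (v \in codom S'),
        forall i, S i \notin u -> S' i = S i
      & forall i, S i \in u -> S' i = next u (S i)].

Definition valid_move (S S' : config) : Prop :=
  [\/ path_move S S', rotation_move S S' | S = S'].

Definition reachable (S T : config) : Prop :=
  exists (t : nat) (s : nat -> config),
    [/\ s 0 = S, s t = T & forall k, k < t -> valid_move (s k) (s k.+1)].

Definition universally_solvable : Prop := forall S T : config, reachable S T.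

End Robots.

(* Main.v *)
(** When every vertex carries a robot only rotations move anything, so a robot
    standing on a vertex of degree less than two is stuck forever.  In a star
    with n leaves every leaf must therefore be covered by a new edge, and one
    edge covers at most two leaves. *)
Require Import Defs.
From mathcomp Require Import fingroup perm.
From mathcomp Require Import all_boot all_order all_algebra.
Import Order.TTheory GRing.Theory Num.Theory.
Local Open Scope ring_scope.
Set Implicit Arguments.
Unset Strict Implicit.
Unset Printing Implicit Defensive.

(** Since [next s] is injective, the claim amounts to [next s (next s x) != x]. Rotated to start at
    [x], the cycle reads [x, a, b, ...], and [b] differs from [x]. *)
Lemma next_neq_prev (T : eqType) (s : seq T) (x : T) :
  uniq s -> (2 < size s)%N -> x \in s -> next s x != prev s x.
Proof.
move=> us ss xs; rewrite -(inj_eq (can_inj (prev_next us))) next_prev //.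
have [i s' def_s] := rot_to xs.
rewrite -2!(next_rot i us) def_s.
move: us ss; rewrite -(rot_uniq i) -(size_rot i) def_s.
case: s' {def_s} => [|a [|b s']] //=; rewrite eqxx !inE !negb_or.
by case/andP=> /and3P[xa xb _] _ _; rewrite (ifN_eqC _ _ xa) eqxx eq_sym.
Qed.

Lemma adjC (G : graph) (x y : G) : adj x y = adj y x.
Proof. by rewrite /adj setUC. Qed.

Lemma codom_full_config (H : graph) (S : config H #|H|) (v : H) : v \in codom S.
Proof.
have injS : injective S by apply/injectiveP/pos_inj.
by rewrite (inj_card_onto injS) // card_ord.
Qed.

(** Degree at most one, phrased so that the two cycle neighbours of [v] can be plugged in for [a]
    and [b]. *)
Definition stuck (H : graph) (v : H) :=
  forall a b : H, adj v a -> adj v b -> a = b.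

Lemma stuck_valid_move (H : graph) (v : H) (S S' : config H #|H|) i :
  stuck v -> valid_move S S' -> S i = v -> S' i = v.
Proof.
move=> stuck_v [[u0 [us [_ + _ _ _]]]|[u [[su /andP[cu uu] _ fixed _]]]|-> //].
  (* A path move needs an unoccupied end vertex, but [#|H|] robots fill [H]. *)
  by rewrite codom_full_config.
move=> Si; rewrite fixed // Si; apply/negP => vu.
(* A rotation through [v] would give [v] two distinct neighbours, its successor and its
   predecessor. *)
case/eqP: (next_neq_prev uu su vu).
by apply: stuck_v; rewrite ?next_cycle // adjC prev_cycle.
Qed.

Lemma stuck_reachable (H : graph) (v : H) (S T : config H #|H|) i :
  stuck v -> reachable S T -> S i = v -> T i = v.
Proof.
move=> stuck_v [t [s [<- <- moves]]] S_i.
elim: t moves => // t IHt moves.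
apply: (stuck_valid_move stuck_v (moves t _)) => //.
by apply: IHt => k kt; apply: moves; apply: ltnW.
Qed.

Lemma perm_config_inj (H : graph) (f : {perm H}) :
  injectiveb [ffun i : 'I_#|H| => f (enum_val i)].
Proof.
by apply/injectiveP => i j; rewrite !ffunE => /perm_inj/enum_val_inj.
Qed.

(** The identity placement cannot reach the one exchanging [v] and [w]: the robot on [v] would have
    to leave it. *)
Lemma stuck_not_universally_solvable (H : graph) (v w : H) :
  v != w -> stuck v -> ~ universally_solvable H #|H|.
Proof.
move=> vw stuck_v solv.
have := stuck_reachable (i := enum_rank v) stuck_v
  (solv (Config (@perm_config_inj H 1%g)) (Config (@perm_config_inj H (tperm v w)))).
rewrite /= !ffunE enum_rankK perm1 tpermL => /(_ erefl) wv.
by rewrite wv eqxx in vw.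
Qed.

(** [None] is the centre and each [Some i] a leaf. *)
Definition star_edges (n : nat) : {set {set option 'I_n}} :=
  [set [set None; Some i] | i : 'I_n].

Lemma star_edges_card2 (n : nat) (e : {set option 'I_n}) :
  e \in star_edges n -> #|e| = 2.
Proof. by case/imsetP => i _ ->; rewrite cards2. Qed.

Definition star (n : nat) : graph := Graph (@star_edges_card2 n).

Lemma card_star n : #|star n| = n.+1.
Proof. by rewrite card_option card_ord. Qed.

Lemma adj_star_center n (i : 'I_n) : @adj (star n) None (Some i).
Proof. exact: imset_f. Qed.

Lemma adj_star_leaf n (i : 'I_n) (x : star n) : adj (Some i : star n) x -> x = None.
Proof.
(* Every edge contains [None], and [Some i] is not [None], so the other end is. *)
case/imsetP => j _ /setP eq_e; have := eq_e None.
by rewrite !inE /=; case: x {eq_e}.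
Qed.

Lemma connected_star n : connected (star n).
Proof.
split=> [|x y]; first by rewrite card_star.
have to_center z : connect (@adj (star n)) z None.
  case: z => [i|]; last exact: connect0.
  by apply: connect1; rewrite adjC adj_star_center.
apply: connect_trans (to_center x) _.
by rewrite (sym_connect_sym (@adjC (star n))) to_center.
Qed.

Lemma isomorphic_card (G H : graph) : isomorphic G H -> #|G| = #|H|.
Proof. by case=> f [/bij_eq_card]. Qed.

(** A leaf that no edge of [F] touches keeps the centre as its only neighbour, hence is stuck. *)
Lemma star_leaf_covered n (F : {set {set star n}})
    (newF : F \subset non_edges (star n)) (i : 'I_n) :
  universally_solvable (add_edges newF) #|star n| -> Some i \in cover F.
Proof.
move=> solv; apply/negPn/negP => uncovered.
apply: (@stuck_not_universally_solvable (add_edges newF) (Some i) None) solv => //.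
have only_center (x : star n) : @adj (add_edges newF) (Some i) x -> x = None.
  rewrite /adj inE => /orP[/adj_star_leaf //|inF].
  by case/negP: uncovered; apply/bigcupP; exists [set Some i; x]; rewrite ?set21.
by move=> a b /only_center -> /only_center ->.
Qed.

Lemma star_new_edges n (F : {set {set star n}})
    (newF : F \subset non_edges (star n)) :
  universally_solvable (add_edges newF) #|star n| -> (n <= 2 * #|F|)%N.
Proof.
move=> solv.
have leaves : [set Some i | i : 'I_n] \subset cover F.
  by apply/subsetP => _ /imsetP[i _ ->]; apply: star_leaf_covered solv.
have cardF : \sum_(e in F) #|e| = (2 * #|F|)%N.
  rewrite mulnC -sum_nat_const; apply: eq_bigr => e /(subsetP newF).
  by rewrite inE => /andP[/eqP].
have := subset_leq_card leaves.
rewrite card_imset ?card_ord; last by move=> i j [].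
(* Union bound: a cover is no larger than the sum of the sizes of its sets. *)
by move=> /leq_trans -> //; rewrite -cardF; apply: leq_card_cover.
Qed.

Theorem theorem27 :
  exists Gs : nat -> graph,
    (forall m n : nat, isomorphic (Gs m) (Gs n) -> m = n) /\
    (forall n : nat,
       connected (Gs n) /\
       (forall (F : {set {set Gs n}}) (newF : F \subset non_edges (Gs n)),
          universally_solvable (add_edges newF) #|Gs n| ->
          (#|Gs n|%:R - 1) / 2%:R <= #|F|%:R :> rat)).
Proof.
exists star; split=> [m n /isomorphic_card|n].
  (* Non-isomorphism within the family comes from the vertex counts [n.+1]. *)
  by rewrite !card_star => -[].
split=> [|F newF /star_new_edges leF]; first exact: connected_star.
by rewrite card_star -natr1 addrK ler_pdivrMr // -natrM ler_nat mulnC.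
Qed.
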